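(* Let $\mathbb K=(A,\prec,\mathcal D)$ be a defined proto sdp-algebra with $A$ a bounded lattice (a co-Heyting algebra for items 3 and 4), and let $\overline{\mathcal D}=(A\times A)\setminus\mathcal D$. Let $\lhd a=\bigwedge\{b\in A\mid a\,\overline{\mathcal D}\,b\}$ in $A^\delta$. For $1\le i\le4$ let $\prec_i$, $\overline{\mathcal D}_i$ be the closures of $\prec$, $\overline{\mathcal D}$ defined in the context, and let $\Diamond_ia=\bigwedge\{b\in A\mid a\prec_ib\}$ and $\lhd_ia=\bigwedge\{b\in A\mid a\,\overline{\mathcal D}_i\,b\}$ in $A^\delta$. Among maps $f:A\to A^\delta$ with $f(a)\in K(A^\delta)$ for all $a\in A$, ordered pointwise: 1. $\lhd_1$ is the largest antitone map dominated by $\lhd$. 2. $\lhd_2$ is the largest regular map dominated by $\lhd$. 3. $\lhd_3$ is the largest antitone map $f$ dominated by $\lhd$ which satisfies $f(a)\le\Diamond_3(f(a)\setminus a)$ for all $a\in A$. 4. $\lhd_4$ is the largest regular map $f$ dominated by $\lhd$ which satisfies $f(a)\le\Diamond_4(f(a)\setminus a)$ for all $a\in A$. (In each item it is part of the claim that $\lhd_i$ itself is a map of the stated kind.)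
   Context: Canonical extension. For a poset $A$, $A^\delta$ is a complete lattice containing $A$ as a subposet. $k\in A^\delta$ is closed ($k\in K(A^\delta)$) if $k=\bigwedge F$ for some nonempty down-directed $F\subseteq A$; $o$ is open if $o=\bigvee I$ for some nonempty up-directed $I\subseteq A$. Denseness: every element of $A^\delta$ is a join of closed elements and a meet of open elements. Compactness: if $F\subseteq A$ is nonempty down-directed, $I\subseteq A$ nonempty up-directed and $\bigwedge F\le\bigvee I$, then $a\le b$ for some $a\in F$, $b\in I$. $A^\delta$ exists and is unique up to isomorphism fixing $A$. A co-Heyting algebra is a (bounded) distributive lattice with a binary operation $\setminus$ such that $a\setminus b\le c$ iff $a\le c\vee b$. In that case, for $u,v\in A^\delta$, $u\setminus v$ denotes the least $w\in A^\delta$ with $u\le w\vee v$. A proto sdp-algebra is $(A,\prec,\mathcal D)$ with $\prec,\mathcal D\subseteq A\times A$. It is defined if for $\prec$: $\forall a\exists b(b\prec a)$; $\forall a\exists b(a\prec b)$; $a\prec x_1\ \&\ a\prec x_2\Rightarrow\exists x(a\prec x\ \&\ x\le x_1\ \&\ x\le x_2)$; $a_1\prec x\ \&\ a_2\prec x\Rightarrow\exists a(a\prec x\ \&\ a_1\le a\ \&\ a_2\le a)$; and for $\overline{\mathcal D}$: $\forall a\exists b(b\,\overline{\mathcal D}\,a)$; $\forall a\exists b(a\,\overline{\mathcal D}\,b)$; $a\,\overline{\mathcal D}\,x_1\ \&\ a\,\overline{\mathcal D}\,x_2\Rightarrow\exists x(x\le x_1\ \&\ x\le x_2\ \&\ a\,\overline{\mathcal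 D}\,x)$; $a_1\,\overline{\mathcal D}\,x\ \&\ a_2\,\overline{\mathcal D}\,x\Rightarrow\exists a(a\le a_1\ \&\ a\le a_2\ \&\ a\,\overline{\mathcal D}\,x)$. $\prec_i$ is the smallest extension of $\prec$ satisfying: $\top\prec\top$, $a\le b\prec x\Rightarrow a\prec x$, $b\prec x\le y\Rightarrow b\prec y$, $a\prec x\ \&\ a\prec y\Rightarrow a\prec x\wedge y$; together with, for $i\in\{2,4\}$, $a\prec x\ \&\ b\prec x\Rightarrow a\vee b\prec x$; and, for $i\in\{3,4\}$, $a\prec b\ \&\ a\wedge b\prec c\Rightarrow a\prec c$. $\overline{\mathcal D}_i$ is the smallest extension $N$ of $\overline{\mathcal D}$ satisfying: $\bot\,N\,\top$; $a\le b\ \&\ a\,N\,c\Rightarrow b\,N\,c$; $a\,N\,c\ \&\ c\le b\Rightarrow a\,N\,b$; $a\,N\,b\ \&\ a\,N\,c\Rightarrow a\,N\,(b\wedge c)$; together with, for $i\in\{2,4\}$, $a\,N\,c\ \&\ b\,N\,c\Rightarrow(a\wedge b)\,N\,c$; and, for $i\in\{3,4\}$, $a\,N\,b\ \&\ (b\setminus a)\prec_ic\Rightarrow a\,N\,c$. $f$ is dominated by $\lhd$ if $f(a)\le\lhd a$ for all $a\in A$; antitone if $a\le b$ implies $f(b)\le f(a)$; regular if $f(a\wedge b)=f(a)\vee f(b)$ for all $a,b\in A$. $\Diamond_i$ is evaluated at a closed element $k$ by $\Diamond_ik:=\bigwedge\{\Diamond_ic\mid c\in A,k\le c\}$ (the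 element $f(a)\setminus a$ is closed). *)

(* Defs.v *)
From HB Require Import structures.
From mathcomp Require Import all_boot all_order.
From mathcomp Require Import mathcomp_extra boolp classical_sets.

Set Implicit Arguments.
Unset Strict Implicit.
Unset Printing Implicit Defensive.

Import Order.TTheory.

Local Open Scope classical_set_scope.
Local Open Scope order_scope.

HB.mixin Record isCompleteLattice d T of Order.TBLattice d T := {
  cinf : set T -> T;
  csup : set T -> T;
  cinfP : forall S : set T, infimums S (cinf S);
  csupP : forall S : set T, supremums S (csup S)
}.

#[short(type="completeLatticeType")]
HB.structure Definition CompleteLattice d :=
  { T of isCompleteLattice d T & Order.TBLattice d T }.

(* The operation [cohdiff a b] is the co-Heyting difference a \ b. *)
HB.mixin Record isCoHeyting d T of Order.TBDistrLattice d T := {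
  cohdiff : T -> T -> T;
  cohdiffP : forall a b c : T, (cohdiff a b <= c) = (a <= c `|` b)
}.

#[short(type="coHeytingType")]
HB.structure Definition CoHeyting d :=
  { T of isCoHeyting d T & Order.TBDistrLattice d T }.

Definition down_directed d (A : porderType d) (F : set A) : Prop :=
  forall x y, F x -> F y -> exists z, [/\ F z, z <= x & z <= y].

Definition up_directed d (A : porderType d) (I : set A) : Prop :=
  forall x y, I x -> I y -> exists z, [/\ I z, x <= z & y <= z].

Section CanonicalExtension.
Variables (d dC : Order.disp_t) (A : porderType d) (C : completeLatticeType dC).
Variable e : A -> C.

Definition closed_elt (k : C) : Prop :=
  exists F : set A, [/\ F !=set0, down_directed F & k = cinf (e @` F)].

Definition open_elt (o : C) : Prop :=
  exists I : set A, [/\ I !=set0, up_directed I & o = csup (e @` I)].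

Record canonical_extension : Prop := CanonicalExtension {
  ce_embedding : forall a b : A, (e a <= e b) = (a <= b);
  ce_join_closed : forall u : C,
    exists2 S : set C, S `<=` closed_elt & u = csup S;
  ce_meet_open : forall u : C,
    exists2 S : set C, S `<=` open_elt & u = cinf S;
  ce_compact : forall F I : set A,
    F !=set0 -> down_directed F -> I !=set0 -> up_directed I ->
    cinf (e @` F) <= csup (e @` I) ->
    exists a b, [/\ F a, I b & a <= b]
}.

End CanonicalExtension.

Section ProtoSdp.
Variables (d : Order.disp_t) (A : tbLatticeType d).
Implicit Types N P : A -> A -> Prop.

Record proto_sdp := ProtoSdp {
  sdp_prec : A -> A -> Prop;
  sdp_D : A -> A -> Prop
}.

Definition sdp_nD (K : proto_sdp) (a b : A) : Prop := ~ sdp_D K a b.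

Record defined_prec P : Prop := DefinedPrec {
  dp_below : forall a, exists b, P b a;
  dp_above : forall a, exists b, P a b;
  dp_right : forall a x1 x2, P a x1 -> P a x2 ->
    exists x, [/\ P a x, x <= x1 & x <= x2];
  dp_left : forall a1 a2 x, P a1 x -> P a2 x ->
    exists a, [/\ P a x, a1 <= a & a2 <= a]
}.

Record defined_nD N : Prop := DefinedND {
  dn_below : forall a, exists b, N b a;
  dn_above : forall a, exists b, N a b;
  dn_right : forall a x1 x2, N a x1 -> N a x2 ->
    exists x, [/\ x <= x1, x <= x2 & N a x];
  dn_left : forall a1 a2 x, N a1 x -> N a2 x ->
    exists a, [/\ a <= a1, a <= a2 & N a x]
}.

Definition defined_sdp (K : proto_sdp) : Prop :=
  defined_prec (sdp_prec K) /\ defined_nD (sdp_nD K).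

(* The intersection of all extensions of R satisfying [rules]; the rules used
   below are Horn clauses, so it satisfies them and is the least such
   extension. *)
Definition smallest_ext (rules : (A -> A -> Prop) -> Prop)
    (R : A -> A -> Prop) (a b : A) : Prop :=
  forall N, (forall x y, R x y -> N x y) -> rules N -> N a b.

Record prec_rules (i : nat) P : Prop := PrecRules {
  pr_top : P \top \top;
  pr_si : forall a b x, a <= b -> P b x -> P a x;
  pr_wo : forall b x y, P b x -> x <= y -> P b y;
  pr_and : forall a x y, P a x -> P a y -> P a (x `&` y);
  pr_or : i \in [:: 2; 4] -> forall a b x, P a x -> P b x -> P (a `|` b) x;
  pr_ct : i \in [:: 3; 4] ->
    forall a b c, P a b -> P (a `&` b) c -> P a c
}.

Definition prec_cl (i : nat) (K : proto_sdp) : A -> A -> Prop :=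
  smallest_ext (prec_rules i) (sdp_prec K).

(* All the rules for the complement of D except the one using the co-Heyting
   difference; for i = 1 and i = 2 these are all the rules. *)
Record nD_rules (i : nat) N : Prop := NDRules {
  nr_bot : N \bot \top;
  nr_left : forall a b c, a <= b -> N a c -> N b c;
  nr_right : forall a b c, N a c -> c <= b -> N a b;
  nr_and : forall a b c, N a b -> N a c -> N a (b `&` c);
  nr_meet : i \in [:: 2; 4] ->
    forall a b c, N a c -> N b c -> N (a `&` b) c
}.

Definition nD_cl (i : nat) (K : proto_sdp) : A -> A -> Prop :=
  smallest_ext (nD_rules i) (sdp_nD K).

End ProtoSdp.

Section ProtoSdpCoHeyting.
Variables (d : Order.disp_t) (A : coHeytingType d).

Definition nD_ct_rule (i : nat) (K : proto_sdp A) (N : A -> A -> Prop) : Prop :=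
  i \in [:: 3; 4] -> forall a b c, N a b -> prec_cl i K (cohdiff b a) c -> N a c.

Definition nD_cl_ct (i : nat) (K : proto_sdp A) : A -> A -> Prop :=
  smallest_ext (fun N => nD_rules i N /\ nD_ct_rule i K N) (sdp_nD K).

End ProtoSdpCoHeyting.

Section Maps.
Variables (d dC : Order.disp_t) (A : tbLatticeType d).
Variables (C : completeLatticeType dC) (e : A -> C).
Implicit Types f g : A -> C.

(* The diamond map of R = prec, resp. the triangle map of R = complement of D. *)
Definition slanted (R : A -> A -> Prop) (a : A) : C :=
  cinf (e @` [set b | R a b]).

(* Extension of a map on A to the closed elements of C. *)
Definition closed_ext f (k : C) : C := cinf (f @` [set c | k <= e c]).

(* The difference u \ v, i.e. the least w with u <= w \/ v: when A is a
   co-Heyting algebra, joins in C distribute over meets, so the infimum below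
   belongs to the set of such w. *)
Definition cdiff (u v : C) : C := cinf [set w | u <= w `|` v].

Definition dominated g f : Prop := forall a, f a <= g a.

Definition antitone f : Prop := forall a b, a <= b -> f b <= f a.

Definition regular f : Prop := forall a b, f (a `&` b) = f a `|` f b.

Definition diff_bounded (P : A -> A -> Prop) f : Prop :=
  forall a, f a <= closed_ext (slanted P) (cdiff (f a) (e a)).

Definition largest_closed_map (Q : (A -> C) -> Prop) g : Prop :=
  [/\ forall a, closed_elt e (g a), Q g &
      forall f, (forall a, closed_elt e (f a)) -> Q f -> forall a, f a <= g a].

End Maps.

(* Main.v *)
(* Compactness turns a closed element [k] into the filter of those [b] with
   [k <= e b]; a map [f] with closed values thus corresponds to the relation
   [f a <= e b], and each clause on maps becomes one of the rules on relations.
   Minimality of the closure then says maximality of its triangle map. *)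
Require Import Defs.
From mathcomp Require Import all_boot all_order.
From mathcomp Require Import classical_sets.

Set Implicit Arguments.
Unset Strict Implicit.
Unset Printing Implicit Defensive.

Import Order.TTheory.

Local Open Scope classical_set_scope.
Local Open Scope order_scope.

(** * Bounds for arbitrary infima and suprema *)

Section CompleteLatticeTheory.
Variables (dC : Order.disp_t) (C : completeLatticeType dC).
Implicit Types (S : set C) (x : C).

Lemma cinf_le S x : S x -> cinf S <= x.
Proof. by have [h _] := cinfP S; apply: h. Qed.

Lemma cinf_glb S x : (forall y, S y -> x <= y) -> x <= cinf S.
Proof. by have [_ h] := cinfP S; apply: h. Qed.

Lemma csup_le S x : S x -> x <= csup S.
Proof. by have [h _] := csupP S; apply: h. Qed.

Lemma csup_lub S x : (forall y, S y -> y <= x) -> csup S <= x.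
Proof. by have [_ h] := csupP S; apply: h. Qed.

End CompleteLatticeTheory.

(** * Compactness and denseness in the canonical extension *)

Section CanonicalExtensionTheory.
Variables (d dC : Order.disp_t) (A : tbLatticeType d).
Variables (C : completeLatticeType dC) (e : A -> C).
Hypothesis ce : canonical_extension e.
Implicit Types (F I : set A) (k u v : C).

Lemma cinf_image_le_open F I :
  F !=set0 -> down_directed F -> I !=set0 -> up_directed I ->
  cinf (e @` F) <= csup (e @` I) -> exists2 a, F a & exists2 b, I b & a <= b.
Proof.
move=> F0 Fd I0 Id h; have [a [b [Fa Ib ab]]] := ce_compact ce F0 Fd I0 Id h.
by exists a => //; exists b.
Qed.

(** Compactness with the singleton of [b] as the up-directed set. *)
Lemma cinf_image_le F b :
  F !=set0 -> down_directed F -> cinf (e @` F) <= e b ->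
  exists2 a, F a & a <= b.
Proof.
move=> F0 Fd h.
have [|||a Fa [_ -> ab]] := @cinf_image_le_open F [set b] F0 Fd.
- by exists b.
- by move=> _ _ -> ->; exists b.
- by apply: le_trans h _; apply: csup_le; exists b.
by exists a.
Qed.

Lemma le_csup_image a I :
  I !=set0 -> up_directed I -> e a <= csup (e @` I) -> exists2 b, I b & a <= b.
Proof.
move=> I0 Id h.
have [|||_ -> //] := @cinf_image_le_open [set a] I _ _ I0 Id.
- by exists a.
- by move=> _ _ -> ->; exists a.
- by apply: le_trans h; apply: cinf_le; exists a.
Qed.

(** By denseness [v] is a meet of open elements, all of which lie above [v]; so open upper bounds of
    [v] suffice to test the inequality. *)
Lemma le_by_open u v :
  (forall I, I !=set0 -> up_directed I ->
    v <= csup (e @` I) -> u <= csup (e @` I)) -> u <= v.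
Proof.
move=> h; have [S Sopen vE] := ce_meet_open ce v; rewrite vE.
apply: cinf_glb => o So.
have [I [I0 Id oE]] := Sopen _ So.
by rewrite oE; apply: h => //; rewrite -oE vE; apply: cinf_le.
Qed.

(** Compactness finds members of the directed set [F] below [a] and below [b]; a common lower bound
    of them in [F] lies below the meet. *)
Lemma closed_le_meet k a b :
  closed_elt e k -> k <= e a -> k <= e b -> k <= e (a `&` b).
Proof.
move=> [F [F0 Fd ->]] /(cinf_image_le F0 Fd)[x Fx xa].
move=> /(cinf_image_le F0 Fd)[y Fy yb].
have [z [Fz zx zy]] := Fd _ _ Fx Fy.
apply: (@le_trans _ _ (e z)); first by apply: cinf_le; exists z.
by rewrite (ce_embedding ce) lexI (le_trans zx xa) (le_trans zy yb).
Qed.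

Lemma closed_le_top k : closed_elt e k -> k <= e \top.
Proof.
move=> [F [[a Fa] _ ->]]; apply: (@le_trans _ _ (e a)).
  by apply: cinf_le; exists a.
by rewrite (ce_embedding ce) lex1.
Qed.

(** [e] is given only as an order embedding. An open element above [e a] and [e b] comes from a
    directed [I]; compactness puts [a] and [b] below members of [I], hence their join below a single
    one. *)
Lemma ce_join_le a b : e (a `|` b) <= e a `|` e b.
Proof.
apply: le_by_open => I I0 Id; rewrite leUx => /andP[].
move=> /(le_csup_image I0 Id)[x Ix ax] /(le_csup_image I0 Id)[y Iy bY].
have [z [Iz xz yz]] := Id _ _ Ix Iy.
apply: (@le_trans _ _ (e z)); last by apply: csup_le; exists z.
by rewrite (ce_embedding ce) leUx (le_trans ax xz) (le_trans bY yz).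
Qed.

(** * Triangle maps of relations that satisfy the rules *)

Section Slanted.
Variables (i : nat) (N : A -> A -> Prop).
Hypothesis NP : nD_rules i N.

Lemma nD_rules_top a : N a \top.
Proof. by apply: (nr_left NP) (nr_bot NP); rewrite le0x. Qed.

Lemma nD_rules_filter a :
  [set b | N a b] !=set0 /\ down_directed [set b | N a b].
Proof.
split; first by exists \top; apply: nD_rules_top.
move=> x y /= Nx Ny; exists (x `&` y).
by split; [apply: (nr_and NP)|rewrite leIl|rewrite leIr].
Qed.

Lemma slanted_closed a : closed_elt e (slanted e N a).
Proof. by have [N0 Nd] := nD_rules_filter a; exists [set b | N a b]. Qed.

Lemma slanted_antitone : antitone (slanted e N).
Proof.
move=> a b ab; apply: cinf_glb => _ [c Nc <-].
by apply: cinf_le; exists c => //; apply: (nr_left NP) ab Nc.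
Qed.

Lemma slanted_regular : i \in [:: 2; 4] -> regular (slanted e N).
Proof.
move=> i24 a b; apply/le_anti/andP; split; last first.
  by rewrite leUx !slanted_antitone ?leIl ?leIr.
(* An open element above both values contains, by compactness, some [e y] and [e y'] with [y] and
   [y'] above successors of [a] and [b]. A bound [z] of both in [I] is then a common successor, as
   [nr_meet] requires. *)
apply: le_by_open => I I0 Id; rewrite leUx => /andP[].
have [Na0 Nad] := nD_rules_filter a; have [Nb0 Nbd] := nD_rules_filter b.
move=> /(cinf_image_le_open Na0 Nad I0 Id)[x Nx [y Iy xy]].
move=> /(cinf_image_le_open Nb0 Nbd I0 Id)[x' Nx' [y' Iy' xy']].
have [z [Iz yz yz']] := Id _ _ Iy Iy'.
apply: (@le_trans _ _ (e z)); last by apply: csup_le; exists z.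
apply: cinf_le; exists z => //; apply: (nr_meet NP i24).
  by apply: (nr_right NP) Nx _; apply: le_trans yz.
by apply: (nr_right NP) Nx' _; apply: le_trans yz'.
Qed.

Lemma slanted_dominated (M : A -> A -> Prop) :
  (forall a b, M a b -> N a b) -> dominated (slanted e M) (slanted e N).
Proof.
move=> MN a; apply: cinf_glb => _ [b Mb <-].
by apply: cinf_le; exists b => //; apply: MN.
Qed.

End Slanted.

(** This relation is the competitor against which minimality of the closure is applied. *)
Lemma le_rel_nD_rules i (f : A -> C) :
  (forall a, closed_elt e (f a)) -> antitone f ->
  (i \in [:: 2; 4] -> regular f) -> nD_rules i (fun a b => f a <= e b).
Proof.
move=> fc fa fr; split.
- exact: closed_le_top.
- by move=> a b c ab; apply: le_trans; apply: fa.
- by move=> a b c fac cb; apply: le_trans fac _; rewrite (ce_embedding ce).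
- by move=> a b c; apply: closed_le_meet.
- by move=> i24 a b c ac bc; rewrite (fr i24) leUx ac.
Qed.

Lemma dominated_le_rel (M : A -> A -> Prop) (f : A -> C) a b :
  dominated (slanted e M) f -> M a b -> f a <= e b.
Proof. by move=> fM Mab; apply: le_trans (fM a) _; apply: cinf_le; exists b. Qed.

Lemma regular_antitone (f : A -> C) : regular f -> antitone f.
Proof. by move=> fr a b /meet_idPl <-; rewrite fr leUr. Qed.

End CanonicalExtensionTheory.

(** * Least extensions satisfy their own rules *)

Section Closures.
Variables (d : Order.disp_t).

Lemma smallest_ext_sub (A : tbLatticeType d) rules (R : A -> A -> Prop) a b :
  R a b -> smallest_ext rules R a b.
Proof. by move=> Rab N RN _; apply: RN. Qed.

(** Keeping [rules] abstract covers the closures with and without the co-Heyting rule. *)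
Lemma smallest_ext_nD_rules (A : tbLatticeType d) i rules (R : A -> A -> Prop) :
  (forall N, rules N -> nD_rules i N) -> nD_rules i (smallest_ext rules R).
Proof.
move=> rP; split.
- by move=> N _ /rP NP; apply: (nr_bot NP).
- move=> a b c ab h N RN rN; apply: (nr_left (rP _ rN)) ab _; exact: h.
- move=> a b c h cb N RN rN; apply: (nr_right (rP _ rN)) _ cb; exact: h.
- move=> a b c hb hc N RN rN.
  by apply: (nr_and (rP _ rN)); [apply: hb|apply: hc].
- move=> i24 a b c ha hb N RN rN.
  by apply: (nr_meet (rP _ rN) i24); [apply: ha|apply: hb].
Qed.

Lemma prec_cl_si (A : tbLatticeType d) i (K : proto_sdp A) a b x :
  a <= b -> prec_cl i K b x -> prec_cl i K a x.
Proof. by move=> ab h N RN NP; apply: (pr_si NP) ab _; apply: h. Qed.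

Lemma nD_cl_ct_nD_rules (A : coHeytingType d) i (K : proto_sdp A) :
  nD_rules i (nD_cl_ct i K).
Proof. by apply: smallest_ext_nD_rules => N []. Qed.

Lemma nD_cl_ct_ct_rule (A : coHeytingType d) i (K : proto_sdp A) :
  nD_ct_rule i K (nD_cl_ct i K).
Proof.
move=> i34 a b c Nab Pc N RN rN; have [_ ct] := rN.
by apply: (ct i34) Pc; apply: Nab.
Qed.

End Closures.

(** * The difference on the extension and the rule for it *)

Section CoHeytingDifference.
Variables (d dC : Order.disp_t) (A : coHeytingType d).
Variables (C : completeLatticeType dC) (e : A -> C).
Hypothesis ce : canonical_extension e.

(** Residuation gives [b <= cohdiff b a]|[a], and [ce_join_le] splits the image of this join, so
    [e (cohdiff b a)] belongs to the set whose infimum is [cdiff u (e a)]. *)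
Lemma cdiff_le_cohdiff (u : C) a b :
  u <= e b -> cdiff u (e a) <= e (cohdiff b a).
Proof.
move=> ub; apply: cinf_le => /=; apply: le_trans ub _.
apply: le_trans (ce_join_le ce _ _).
by rewrite (ce_embedding ce) -cohdiffP.
Qed.

(* With [u := cinf (e @` F)], any [w] with [u <= w `|` e a] is a meet of open
   elements [o]; as [o `|` e a] is open, compactness applied to
   [u <= o `|` e a] gives [b] in [F] with [e (cohdiff b a) <= o]. *)
Lemma cinf_cohdiff_le_cdiff (F : set A) a :
  F !=set0 -> down_directed F ->
  cinf (e @` (cohdiff^~ a @` F)) <= cdiff (cinf (e @` F)) (e a).
Proof.
move=> F0 Fd; apply: cinf_glb => w /= uw.
apply: (le_by_open ce) => I I0 Id wI.
have [|||b Fb [_ [x Ix <-]]] :=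
  cinf_image_le_open ce F0 Fd (I := Order.join^~ a @` I).
- by have [x Ix] := I0; exists (x `|` a), x.
- move=> _ _ [x Ix <-] [y Iy <-]; have [z [Iz xz yz]] := Id _ _ Ix Iy.
  by exists (z `|` a); split; [exists z|exact: leU2|exact: leU2].
- have [x Ix] := I0; apply: le_trans uw _; rewrite leUx; apply/andP; split.
    apply: le_trans wI _; apply: csup_lub => _ [y Iy <-].
    apply: (@le_trans _ _ (e (y `|` a))); first by rewrite (ce_embedding ce) leUl.
    by apply: csup_le; exists (y `|` a) => //; exists y.
  apply: (@le_trans _ _ (e (x `|` a))); first by rewrite (ce_embedding ce) leUr.
  by apply: csup_le; exists (x `|` a) => //; exists x.
rewrite -cohdiffP => bx.
apply: (@le_trans _ _ (e (cohdiff b a))).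
  by apply: cinf_le; exists (cohdiff b a) => //; exists b.
apply: (@le_trans _ _ (e x)); first by rewrite (ce_embedding ce).
by apply: csup_le; exists x.
Qed.

Lemma cohdiff_le2 (a b c : A) : b <= c -> cohdiff b a <= cohdiff c a.
Proof. by move=> bc; rewrite cohdiffP; apply: le_trans bc _; rewrite -cohdiffP. Qed.

(** The difference lies above the meet of the [e (cohdiff b a)] for [b] in [F]; these form a
    down-directed family because [cohdiff] is monotone in its first argument, so compactness selects
    one of them. *)
Lemma cdiff_le_ce (F : set A) a c :
  F !=set0 -> down_directed F -> cdiff (cinf (e @` F)) (e a) <= e c ->
  exists2 b, F b & cohdiff b a <= c.
Proof.
move=> F0 Fd /(le_trans (cinf_cohdiff_le_cdiff a F0 Fd)).
move=> /(cinf_image_le ce)[|| _ [b Fb <-] bc]; last by exists b.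
  by have [b Fb] := F0; exists (cohdiff b a), b.
move=> _ _ [x Fx <-] [y Fy <-]; have [z [Fz zx zy]] := Fd _ _ Fx Fy.
by exists (cohdiff z a); split; [exists z|exact: cohdiff_le2|exact: cohdiff_le2].
Qed.

Lemma slanted_diff_bounded i (K : proto_sdp A) :
  i \in [:: 3; 4] ->
  diff_bounded e (prec_cl i K) (slanted e (nD_cl_ct i K)).
Proof.
move=> i34 a; apply: cinf_glb => _ [c /= ac <-].
have [N0 Nd] := nD_rules_filter (nD_cl_ct_nD_rules i K) a.
(* A successor [b] of [a] with [cohdiff b a <= c] lets every [x] with [c] related to [x] pass to
   [cohdiff b a], and the difference rule makes [x] a successor of [a]. *)
have [b Nab bc] := cdiff_le_ce N0 Nd ac.
apply: cinf_glb => _ [x cx <-]; apply: cinf_le; exists x => //.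
by apply: (nD_cl_ct_ct_rule i34) Nab _; apply: prec_cl_si bc cx.
Qed.

Lemma le_rel_ct_rule i (K : proto_sdp A) (f : A -> C) :
  diff_bounded e (prec_cl i K) f -> nD_ct_rule i K (fun a b => f a <= e b).
Proof.
move=> fb _ a b c fab Pc; apply: le_trans (fb a) _.
(* Since [f a <= e b], the element [cohdiff b a] is among those over which [closed_ext] takes its
   infimum. *)
apply: (@le_trans _ _ (slanted e (prec_cl i K) (cohdiff b a))).
  by apply: cinf_le; exists (cohdiff b a) => //; apply: cdiff_le_cohdiff.
by apply: cinf_le; exists c.
Qed.

End CoHeytingDifference.

(** * Maximality of the triangle maps of the closures *)

Section LargestMaps.
Variables (d dC : Order.disp_t) (C : completeLatticeType dC).

(** The relation [f a <= e b] extends the complement of [D] by domination and obeys the rules, so it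
    contains the least such extension: [f a] is a lower bound of the infimum. *)
Lemma le_slanted_nD_cl (A : tbLatticeType d) (e : A -> C) i (K : proto_sdp A)
    (f : A -> C) a :
  canonical_extension e -> (forall a, closed_elt e (f a)) -> antitone f ->
  (i \in [:: 2; 4] -> regular f) -> dominated (slanted e (sdp_nD K)) f ->
  f a <= slanted e (nD_cl i K) a.
Proof.
move=> ce fc fa fr fd; apply: cinf_glb => _ [b Nab <-].
apply: (Nab (fun a b => f a <= e b)); last exact: le_rel_nD_rules.
by move=> x y; apply: dominated_le_rel.
Qed.

Lemma le_slanted_nD_cl_ct (A : coHeytingType d) (e : A -> C) i
    (K : proto_sdp A) (f : A -> C) a :
  canonical_extension e -> (forall a, closed_elt e (f a)) -> antitone f ->
  (i \in [:: 2; 4] -> regular f) -> dominated (slanted e (sdp_nD K)) f ->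
  diff_bounded e (prec_cl i K) f -> f a <= slanted e (nD_cl_ct i K) a.
Proof.
move=> ce fc fa fr fd fb; apply: cinf_glb => _ [b Nab <-].
apply: (Nab (fun a b => f a <= e b)).
  by move=> x y; apply: dominated_le_rel.
by split; [exact: le_rel_nD_rules|exact: le_rel_ct_rule].
Qed.

End LargestMaps.

Theorem proposition6p4 (d dC : Order.disp_t) (C : completeLatticeType dC) :
  (forall (A : tbLatticeType d) (e : A -> C) (K : proto_sdp A),
    canonical_extension e -> defined_sdp K ->
    let lhd := slanted e (sdp_nD K) in
    largest_closed_map e
      (fun f => antitone f /\ dominated lhd f)
      (slanted e (nD_cl 1 K)) /\
    largest_closed_map e
      (fun f => regular f /\ dominated lhd f)
      (slanted e (nD_cl 2 K))) /\
  (forall (A : coHeytingType d) (e : A -> C) (K : proto_sdp A),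
    canonical_extension e -> defined_sdp K ->
    let lhd := slanted e (sdp_nD K) in
    largest_closed_map e
      (fun f => [/\ antitone f, dominated lhd f
                  & diff_bounded e (prec_cl 3 K) f])
      (slanted e (nD_cl_ct 3 K)) /\
    largest_closed_map e
      (fun f => [/\ regular f, dominated lhd f
                  & diff_bounded e (prec_cl 4 K) f])
      (slanted e (nD_cl_ct 4 K))).
Proof.
split=> A e K ce _ lhd.
  have NP i : nD_rules i (nD_cl i K) by apply: smallest_ext_nD_rules.
  have Nd i : dominated lhd (slanted e (nD_cl i K)).
    by apply: slanted_dominated => a b; apply: smallest_ext_sub.
  split; split.
  - exact: slanted_closed (NP 1).
  - by split=> //; apply: slanted_antitone (NP 1).
  - by move=> f fc [fa fd] a; apply: le_slanted_nD_cl.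
  - exact: slanted_closed (NP 2).
  - by split=> //; apply: (slanted_regular ce (NP 2)).
  (* Antitonicity is not listed for regular maps; it follows since [a <= b] means that [a] is the
     meet of [a] and [b]. *)
  - move=> f fc [fr fd] a; apply: le_slanted_nD_cl => //.
    exact: regular_antitone.
have NP i := nD_cl_ct_nD_rules i K.
have Nd i : dominated lhd (slanted e (nD_cl_ct i K)).
  by apply: slanted_dominated => a b; apply: smallest_ext_sub.
split; split.
- exact: slanted_closed (NP 3).
- split=> //; first exact: slanted_antitone (NP 3).
  exact: slanted_diff_bounded.
- by move=> f fc [fa fd fb] a; apply: le_slanted_nD_cl_ct.
- exact: slanted_closed (NP 4).
- split=> //; first exact: (slanted_regular ce (NP 4)).
  exact: slanted_diff_bounded.
- move=> f fc [fr fd fb] a; apply: le_slanted_nD_cl_ct => //.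
  exact: regular_antitone.
Qed.
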